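(* Let $G$ be a countable infinite discrete amenable group and let $\pi:(X,G)\to(Y,G)$ be a factor map between two $G$-action topological dynamical systems. Let $\{F_n\}$ be any tempered F{\o}lner sequence in $G$ satisfying the growth condition $\lim_{n\to+\infty}\frac{|F_n|}{\log n}=+\infty$. Then for any Borel subset $E$ of $X$, $$h^P_{top}(\pi(E),\{F_n\})\le h^P_{top}(E,\{F_n\})\le h^P_{top}(\pi(E),\{F_n\})+\sup_{y\in Y}h^{UC}_{top}(\pi^{-1}(y),\{F_n\}).$$
   Context: A $G$-action topological dynamical system $(X,G)$ consists of a compact metric space $X$ with metric $d$ and a continuous action of the discrete group $G$ on $X$. A factor map $\pi:(X,G)\to(Y,G)$ is a continuous onto map $\pi:X\to Y$ with $\pi\circ g=g\circ\pi$ for all $g\in G$. A F{\o}lner sequence in $G$ is a sequence $\{F_n\}$ of non-empty finite subsets with $\lim_{n\to+\infty}\frac{|F_n\vartriangle gF_n|}{|F_n|}=0$ for all $g\in G$. It is tempered if there is a constant $C>0$ independent of $n$ with $|\bigcup_{k<n}F_k^{-1}F_n|\le C|F_n|$ for all $n$. The following definitions are applied to $X$ and (with the metric of $Y$) to $Y$. For a finite $F\subset G$ put $d_F(x,y)=\max_{g\in F}d(gx,gy)$ and $\overline B_F(x,\varepsilon)=\{y:d_F(x,y)\le\varepsilon\}$. Packing entropy. For $Z\subseteq X$, $s\ge 0$, $N\in\mathbb N$, $\varepsilon>0$, let $P(Z,N,\varepsilon,s,\{F_n\})=\sup\sum_i\exp(-s|F_{n_i}|)$, the supremum over all finite or countable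 pairwise disjoint families $\{\overline B_{F_{n_i}}(x_i,\varepsilon)\}$ with $x_i\in Z$ and $n_i\ge N$ for all $i$. Let $P(Z,\varepsilon,s,\{F_n\})=\lim_{N\to+\infty}P(Z,N,\varepsilon,s,\{F_n\})$ and $$\mathcal P(Z,\varepsilon,s,\{F_n\})=\inf\Big\{\sum_{i=1}^{+\infty}P(Z_i,\varepsilon,s,\{F_n\}):\bigcup_{i=1}^{+\infty}Z_i\supseteq Z\Big\}.$$ $h^P_{top}(Z,\varepsilon,\{F_n\})\in[0,+\infty]$ is the critical value of $s$ at which $\mathcal P(Z,\varepsilon,s,\{F_n\})$ jumps from $+\infty$ to $0$, and $h^P_{top}(Z,\{F_n\})=\lim_{\varepsilon\to0}h^P_{top}(Z,\varepsilon,\{F_n\})$. Upper capacity entropy. A subset $E'\subseteq Z$ is an $(F,\varepsilon)$-separated set of $Z$ if $d_F(x,y)>\varepsilon$ for any two distinct $x,y\in E'$; $s_F(Z,\varepsilon)$ is the largest cardinality of an $(F,\varepsilon)$-separated set of $Z$. Then $$h^{UC}_{top}(Z,\{F_n\})=\lim_{\varepsilon\to0}\limsup_{n\to+\infty}\frac1{|F_n|}\log s_{F_n}(Z,\varepsilon).$$ *)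

(* Defs.v *)
(* MathComp / MathComp-Analysis *)
From HB Require Import structures.
From mathcomp Require Import all_boot all_order all_algebra finmap.
From mathcomp Require Import monoid.
From mathcomp Require Import all_classical all_reals all_analysis.

Set Implicit Arguments.
Unset Strict Implicit.
Unset Printing Implicit Defensive.
Import Order.TTheory GRing.Theory Num.Theory.
Import numFieldNormedType.Exports.

Local Open Scope classical_set_scope.
Local Open Scope ring_scope.

Section Folner.
Context {G : groupType}.
Implicit Types (F : nat -> {fset G}).

Definition ltranslate (g : G) (A : {fset G}) : {fset G} :=
  [fset (g * h)%g | h in A]%fset.

Definition symdiff (A B : {fset G}) : {fset G} :=
  ((A `\` B) `|` (B `\` A))%fset.

Definition invmul (A B : {fset G}) : {fset G} :=
  [fset (g^-1 * h)%g | g in A, h in B]%fset.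

Definition folner (R : realType) F :=
  (forall n, F n != fset0) /\
  (forall g : G,
     (#|` symdiff (F n) (ltranslate g (F n))|%:R / #|` F n|%:R : R)
       @[n --> \oo] --> (0 : R)).

Definition tempered (R : realType) F :=
  exists2 C : R, 0 < C & forall n,
    #|` \big[@fsetU G/fset0]_(k < n) invmul (F k) (F n)|%:R <= C * #|` F n|%:R.

End Folner.

Definition amenable (R : realType) (G : groupType) :=
  exists F : nat -> {fset G}, folner R F.

Definition topological_system {R : realType} {G : groupType} {X : metricType R}
    (a : G -> X -> X) :=
  [/\ compact [set: X],
      forall x, a 1%g x = x,
      forall g h x, a (g * h)%g x = a g (a h x)
    & forall g, continuous (a g)].

Definition factor_map {R : realType} {G : groupType} {X Y : metricType R}
    (a : G -> X -> X) (b : G -> Y -> Y) (p : X -> Y) :=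
  [/\ continuous p, set_surj [set: X] [set: Y] p
    & forall g x, p (a g x) = b g (p x)].

Definition borel {X : topologicalType} (E : set X) :=
  <<s [set U : set X | open U] >> E.

Section Entropy.
Context {R : realType} {G : groupType} {X : metricType R}.
Variable a : G -> X -> X.
Local Open Scope ereal_scope.
Implicit Types (A : {fset G}) (Z : set X) (F : nat -> {fset G}).

Definition bowen_dist A (x y : X) : R :=
  \big[Num.max/0%R]_(g <- A) mdist (a g x) (a g y).

Definition bowen_ball A (x : X) (e : R) : set X :=
  [set y | (bowen_dist A x y <= e)%R].

(* A family of pairs (x_i, n_i) is given by its set of values [I]: nothing is
   lost, since a ball contains its centre (for [0 < e]) and so pairwise
   disjoint balls have pairwise distinct pairs. *)
Definition packing_family Z (N : nat) (e : R) F (I : set (X * nat)) :=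
  [/\ countable I,
      forall p, I p -> Z p.1 /\ (N <= p.2)%N
    & trivIset I (fun p => bowen_ball (F p.2) p.1 e)].

Definition packing_premeasure_at Z (N : nat) (e s : R) F : \bar R :=
  ereal_sup [set \esum_(p in I) (expR (- s * #|` F p.2|%:R))%:E
            | I in packing_family Z N e F].

Definition packing_premeasure Z (e s : R) F : \bar R :=
  limn (fun N => packing_premeasure_at Z N e s F).

Definition packing_measure Z (e s : R) F : \bar R :=
  ereal_inf [set \sum_(0 <= i <oo) packing_premeasure (Zs i) e s F
            | Zs in [set Zs : nat -> set X | Z `<=` \bigcup_i Zs i]].

(* The critical value: [packing_measure Z e s F] is nonincreasing in [s] and,
   when [#|` F n|] tends to +oo, vanishes beyond any [s] at which it is finite,
   so the jump from +oo to 0 takes place at the infimum of its zeros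
   (+oo if there are none). *)
Definition packing_entropy_at Z (e : R) F : \bar R :=
  ereal_inf [set s%:E
            | s in [set s : R | (0 <= s)%R /\ packing_measure Z e s F = 0]].

Definition packing_entropy Z F : \bar R :=
  lim (packing_entropy_at Z e F @[e --> (0 : R)^'+]).

Definition separated_set A Z (e : R) (E : {fset X}) :=
  [set` E] `<=` Z /\
  forall x y, x \in E -> y \in E -> x != y -> (e < bowen_dist A x y)%R.

Definition separated_number A Z (e : R) : \bar R :=
  ereal_sup [set (#|` E|%:R)%:E | E in separated_set A Z e].

Definition capacity_entropy_at Z (e : R) F : \bar R :=
  limn_esup (fun n => (#|` F n|%:R^-1)%:E * lne (separated_number (F n) Z e)).

Definition capacity_entropy Z F : \bar R :=
  lim (capacity_entropy_at Z e F @[e --> (0 : R)^'+]).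

End Entropy.

(* The supremum is taken in [0, +oo]: the maximum with 0 only matters when [Y]
   is empty, as the capacity entropy of a nonempty set is nonnegative. *)
Definition fiber_capacity_entropy {R : realType} {G : groupType}
    {X Y : metricType R} (a : G -> X -> X) (p : X -> Y)
    (F : nat -> {fset G}) : \bar R :=
  maxe 0%E
    (ereal_sup [set capacity_entropy a (p @^-1` [set y]) F | y in [set: Y]]).

(* Main.v *)
Require Import Defs.
From HB Require Import structures.
From mathcomp Require Import all_boot all_order all_algebra finmap.
From mathcomp Require Import monoid.
From mathcomp Require Import all_classical all_reals all_analysis.
From mathcomp Require Import lra.

(* Packing entropy is a modified upper capacity: if the packing pre-measure of
   [Z] at scale [d / 2] and parameter [s] is small, then [(F n, d)]-separated
   subsets of [Z] have at most [exp (s |F n|)] points for large [n]; conversely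
   such a bound with exponent [c] makes the pre-measure vanish beyond [c], since
   the growth condition makes [exp (- t |F n|)] summable. So the second
   inequality reduces to Bowen's: for large [n], uniformly in [z], the preimage
   of the Bowen ball of [z] of radius [d] is covered by [exp (r |F n|)] sets of
   small [F n]-diameter, for any [r] above the capacity entropy of the fibres.

   By compactness each point of [Y] has such a good cover for some [F n] with
   [n] in any prescribed range, but [n] depends on the point. Selecting greedily,
   larger indices first, almost disjoint translates of such [F n] inside a very
   invariant set [T] fills a definite proportion of [T] (this is where temperedness
   enters), and leaves a remainder that is again invariant or negligible.
   Iterating drives the covering rate of [T] down to that of the fibres.

   The first inequality lifts packings through [p] by uniform continuity. *)

Set Implicit Arguments.
Unset Strict Implicit.
Unset Printing Implicit Defensive.
Import Order.TTheory GRing.Theory Num.Theory.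
Import numFieldNormedType.Exports.

Local Open Scope classical_set_scope.
Local Open Scope ring_scope.

(** * Greedy tilings *)

Section Tiles.
Context {G : groupType}.
Implicit Types (A B C K T : {fset G}) (g h k : G) (l S : seq G).

Definition rtranslate A g : {fset G} := [fset (h * g)%g | h in A]%fset.

Lemma mem_rtranslate A g x : (x \in rtranslate A g) = ((x * g^-1)%g \in A).
Proof.
apply/imfsetP/idP => /= [[h hA ->]|xA]; first by rewrite mulgK.
by exists (x * g^-1)%g => //; rewrite mulgVK.
Qed.

Lemma mem_ltranslate A g x : (x \in ltranslate g A) = ((g^-1 * x)%g \in A).
Proof.
apply/imfsetP/idP => /= [[h hA ->]|xA]; first by rewrite mulKg.
by exists (g^-1 * x)%g => //; rewrite mulVKg.
Qed.

Lemma card_rtranslate A g : #|` rtranslate A g| = #|` A|.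
Proof. by rewrite card_imfset//; exact: mulIg. Qed.

Lemma card_ltranslate A g : #|` ltranslate g A| = #|` A|.
Proof. by rewrite card_imfset//; exact: mulgI. Qed.

Lemma symdiffE A B x : (x \in symdiff A B) = ((x \in A) != (x \in B)).
Proof. by rewrite !inE; case: (x \in A); case: (x \in B). Qed.

Lemma count_le_card l A : uniq l -> (count [in A] l <= #|` A|)%N.
Proof.
move=> ul; rewrite -size_filter; apply: uniq_leq_size.
  exact: filter_uniq.
by move=> x; rewrite mem_filter => /andP[].
Qed.

Lemma card_fsetI_sum A B : #|` (A `&` B)%fset| = (\sum_(x <- A) (x \in B))%N.
Proof.
rewrite (eq_bigr (fun x => if x \in B then 1%N else 0%N)); last first.
  by move=> x _; case: (x \in B).
rewrite -big_mkcond sum1_count -size_filter; apply/perm_size/uniq_perm.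
  by rewrite fset_uniq.
  by rewrite filter_uniq// fset_uniq.
by move=> x; rewrite mem_filter inE andbC.
Qed.

(* The [K]-boundary of [T], in a form that is visibly subadditive under
   unions and differences of [T]. *)
Definition boundary K T : nat :=
  (\sum_(k <- K) #|` symdiff T (ltranslate k T)|)%N.

Lemma boundaryS K K' T : (K `<=` K')%fset -> (boundary K T <= boundary K' T)%N.
Proof.
move=> KK'; rewrite /boundary [leqRHS](big_fsetID _ (mem K))/=.
rewrite (_ : [fset x in K' | x \in K]%fset = K) ?leq_addr//.
apply/fsetP => x; rewrite !inE/= andbC.
by case: (boolP (x \in K)) => //= xK; exact: (fsubsetP KK').
Qed.

Lemma boundary_rtranslate K T g : boundary K (rtranslate T g) = boundary K T.
Proof.
apply: eq_bigr => k _; rewrite -(card_rtranslate (symdiff T _) g).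
congr (#|` _|); apply/fsetP => x.
by rewrite mem_rtranslate !symdiffE !mem_ltranslate !mem_rtranslate mulgA.
Qed.

(** If [x] and [k^-1 * x] lie on the same side of [A] and on the same side of [B], they lie on the
    same side of any Boolean combination of them. Union and difference are the two instances
    needed. *)
Lemma boundary_le_comp (op : bool -> bool -> bool) K A B C :
  (forall x, (x \in C) = op (x \in A) (x \in B)) ->
  (boundary K C <= boundary K A + boundary K B)%N.
Proof.
move=> CE; rewrite /boundary -big_split/=; apply: leq_sum => k _.
apply: leq_trans (leq_card_fsetU _ _).1.
apply/fsubset_leq_card/fsubsetP => x.
rewrite in_fsetU !symdiffE !mem_ltranslate !CE.
by do 4 case: (_ \in _); rewrite ?eqxx//; case: op.
Qed.

Lemma boundaryU K A B :
  (boundary K (A `|` B)%fset <= boundary K A + boundary K B)%N.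
Proof. by apply: (@boundary_le_comp orb) => x; rewrite !inE. Qed.

Lemma boundaryD K A B :
  (boundary K (A `\` B)%fset <= boundary K A + boundary K B)%N.
Proof.
by apply: (@boundary_le_comp (fun a b => ~~ b && a)) => x; rewrite !inE.
Qed.

Lemma boundary0 K : boundary K fset0 = 0%N.
Proof.
rewrite /boundary big1// => k _; apply/eqP; rewrite cardfs_eq0.
by apply/eqP/fsetP => x; rewrite symdiffE mem_ltranslate !inE.
Qed.

(** Admissible centres: a tile centred here whose shape is contained in [K] stays inside [T]. *)
Definition core K T : {fset G} :=
  [fset g in T | all (fun k => (k * g)%g \in T) K]%fset.

Lemma coreP K T g : reflect (g \in T /\ forall k, k \in K -> (k * g)%g \in T)
  (g \in core K T).
Proof.
rewrite !inE/=; apply: (iffP andP) => -[gT /= H]; split => //.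
  exact/allP.
exact/allP.
Qed.

(** A point of [T] outside the core is moved out of [T] by some [k] in [K], so it lies in the
    translate by [k^-1] of a difference counted in [boundary K T]. *)
Lemma card_core K T : (#|` T| <= #|` core K T| + boundary K T)%N.
Proof.
have -> : boundary K T = (\sum_(k <- K)
    #|` ltranslate k^-1%g (symdiff T (ltranslate k T))|)%N.
  by apply: eq_bigr => k _; rewrite card_ltranslate.
pose V := (\bigcup_(k <- K)
  ltranslate k^-1%g (symdiff T (ltranslate k T)))%fset.
have VB : (#|` V| <=
    \sum_(k <- K) #|` ltranslate k^-1%g (symdiff T (ltranslate k T))|)%N.
  rewrite /V; elim/big_rec2: _ => [|k m B _ IH]; first by rewrite cardfs0.
  by rewrite (leq_trans (leq_card_fsetU _ _).1)// leq_add2l.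
apply: leq_trans (leq_add (leqnn _) VB).
apply: leq_trans (leq_card_fsetU _ _).1.
apply/fsubset_leq_card/fsubsetP => g gT; rewrite in_fsetU.
case: (boolP (g \in core K T)) => //= gN.
have : ~~ all (fun k => (k * g)%g \in T) K.
  by apply: contra gN => ?; rewrite !inE gT.
case/allPn => k kK kg; apply/bigfcupP; exists k; rewrite ?kK//.
by rewrite mem_ltranslate symdiffE mem_ltranslate invgK mulKg gT (negbTE kg).
Qed.

Definition tiles (F : nat -> {fset G}) (idx : G -> nat) S : {fset G} :=
  (\bigcup_(g <- S) rtranslate (F (idx g)) g)%fset.

Lemma boundary_tiles K F idx S :
  (boundary K (tiles F idx S) <= \sum_(g <- S) boundary K (F (idx g)))%N.
Proof.
rewrite /tiles; elim/big_rec2: _ => [|g m B _ IH]; first by rewrite boundary0.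
by rewrite (leq_trans (boundaryU _ _ _))// boundary_rtranslate leq_add2l.
Qed.

(** * Greedy selection of almost disjoint tiles *)

Section Greedy.
Context {R : realType}.
Variables (F : nat -> {fset G}) (idx : G -> nat) (eta : R).

Let tile g := rtranslate (F (idx g)) g.
Let above S n := tiles F idx [seq h <- S | (n <= idx h)%N].

Lemma greedy_tiles l : eta <= 1 -> sorted (relpre idx leq) l ->
  exists S, [/\ {subset S <= l},
    (1 - eta) * \sum_(g <- S) #|` F (idx g)|%:R <= #|` tiles F idx S|%:R
  & forall g, g \in l ->
      eta * #|` F (idx g)|%:R <= #|` (tile g `&` above S (idx g))%fset|%:R].
Proof.
move=> eta_le1; elim: l => [|g l IH] sl.
  exists [::]; split => //; first by rewrite big_nil mulr0.
have gl : all (fun h => (idx g <= idx h)%N) l.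
  by apply: (order_path_min _ sl) => x y z; exact: leq_trans.
have [S [Sl Sd Sc]] := IH (path_sorted sl).
have [gS|gS] := leP (eta * #|` F (idx g)|%:R)
                    #|` (tile g `&` tiles F idx S)%fset|%:R.
  exists S; split => //; first by move=> h /Sl hl; rewrite inE hl orbT.
  move=> h; rewrite inE => /orP[/eqP->|/Sc//].
  rewrite /above (_ : seq.filter _ _ = S)//; apply/all_filterP/allP => h' /Sl.
  exact: (allP gl).
exists (g :: S); split.
- by move=> h; rewrite !inE => /orP[->//|/Sl ->]; rewrite orbT.
- rewrite big_cons mulrDr /tiles big_cons -/(tiles F idx S) -/(tile g).
  have -> : #|` (tile g `|` tiles F idx S)%fset|%:R =
     #|` F (idx g)|%:R + #|` tiles F idx S|%:R
     - #|` (tile g `&` tiles F idx S)%fset|%:R :> R.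
    by rewrite -(card_rtranslate (F _) g) -natrD -cardfsUI natrD addrK.
  by move: Sd gS; lra.
- move=> h; rewrite inE => /orP[/eqP->|hl].
    rewrite (_ : (_ `&` _)%fset = tile g); last first.
      apply/fsetIidPl; rewrite /above/= leqnn /tiles big_cons.
      exact: fsubsetUl.
    rewrite card_rtranslate; apply: ler_piMl => //.
  apply: (le_trans (Sc h hl)); rewrite ler_nat fsubset_leq_card//.
  apply: fsetIS; rewrite /above/=; case: ifP => // _.
  by rewrite {2}/tiles big_cons fsubsetUr.
Qed.

(* Each centre [g] is charged to the selected tiles it meets: those of larger
   index are met by few centres because [F] is tempered, those of the same
   index because all the tiles involved are translates of a single set. *)
Lemma greedy_tiles_card (C : R) l S : 0 < eta -> uniq l ->
  (forall n, F n != fset0) ->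
  (forall n, #|` \big[@fsetU G/fset0]_(k < n) invmul (F k) (F n)|%:R
     <= C * #|` F n|%:R) ->
  (forall g, g \in l ->
     eta * #|` F (idx g)|%:R <= #|` (tile g `&` above S (idx g))%fset|%:R) ->
  (size l)%:R <= (C + eta^-1) * \sum_(g <- S) #|` F (idx g)|%:R.
Proof.
move=> eta0 ul F0 CF Sc.
(* [D h] contains every centre [g] of smaller index whose tile meets that of [h]: a common point
   [u * g = v * h] gives [g * h^-1 = u^-1 * v]. With the weights [w1] and [w2], each centre receives
   at least 1 in total and each [h] pays at most [C + eta^-1] times the size of its tile. *)
pose D h : {fset G} :=
  rtranslate (\big[@fsetU G/fset0]_(k < idx h) invmul (F k) (F (idx h)))%fset h.
pose w1 g h : R := ((g \in D h) : nat)%:R.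
pose w2 g h : R := if idx g == idx h then
  eta^-1 * (#|` (tile g `&` tile h)%fset|%:R / #|` F (idx h)|%:R) else 0.
have Fgt0 n : 0 < #|` F n|%:R :> R by rewrite ltr0n cardfs_gt0.
have w1_ge0 g h : 0 <= w1 g h by rewrite ler0n.
have w2_ge0 g h : 0 <= w2 g h.
  rewrite /w2; case: ifP => // _.
  by rewrite mulr_ge0 ?invr_ge0 ?divr_ge0// ltW.
have w_ge1 g : g \in l -> 1 <= \sum_(h <- S) (w1 g h + w2 g h).
  move=> gl; have [/hasP[h hS gh]|] := boolP (has (fun h => g \in D h) S).
    rewrite (big_rem h)//= {1}/w1 gh -addrA lerDl.
    rewrite addr_ge0// sumr_ge0// => ? _; exact: addr_ge0.
  move=> /hasPn noD.
  rewrite big_split/=.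
  apply: (@le_trans _ _ (\sum_(h <- S) w2 g h)); last first.
    by rewrite lerDr sumr_ge0.
  (* As [g] is outside every [D h], the tiles of [above S (idx g)] that meet the tile of [g] have
     index exactly [idx g]. *)
  have le2 : #|` (tile g `&` above S (idx g))%fset|%:R <=
     \sum_(h <- S | idx g == idx h) #|` (tile g `&` tile h)%fset|%:R :> R.
    rewrite -natr_sum ler_nat.
    have sub : ((tile g `&` above S (idx g)) `<=`
      \bigcup_(h <- S | idx g == idx h) (tile g `&` tile h))%fset.
      apply/fsubsetP => x; rewrite in_fsetI => /andP[xg].
      move=> /bigfcupP[h]; rewrite andbT mem_filter => /andP[gh hS] xh.
      apply/bigfcupP; exists h; rewrite ?hS//=; last by rewrite in_fsetI xg.
      rewrite eq_sym; move: gh; rewrite leq_eqVlt => /orP[/eqP->//|gh].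
      have /negP[] := noD h hS; rewrite mem_rtranslate.
      apply/bigfcupP; exists (Ordinal gh); first by rewrite mem_index_enum.
      move: xg xh; rewrite !mem_rtranslate => xg xh.
      apply/imfset2P; exists (x * g^-1)%g => //=.
      exists (x * h^-1)%g => //=.
      by rewrite invgM invgK mulgA mulgVK.
    apply: leq_trans (fsubset_leq_card sub) _.
    elim/big_rec2: _ => [|h m B _ IH]; first by rewrite cardfs0.
    by rewrite (leq_trans (leq_card_fsetU _ _).1)// leq_add2l.
  have := le_trans (Sc g gl) le2.
  rewrite -ler_pdivlMl// => le3.
  rewrite -(ler_pM2r (Fgt0 (idx g))) mul1r; apply: (le_trans le3).
  rewrite mulr_sumr mulr_suml [leRHS](bigID (fun h => idx g == idx h))/=.
  rewrite -[leLHS]addr0 lerD//; last first.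
    by apply: sumr_ge0 => h _; rewrite mulr_ge0.
  apply: ler_sum => h gh; rewrite /w2 gh (eqP gh) mulrA divfK//.
  by rewrite gt_eqF.
have sumw h :
    \sum_(g <- l) (w1 g h + w2 g h) <= (C + eta^-1) * #|` F (idx h)|%:R.
  rewrite big_split/= mulrDl lerD//.
    rewrite -natr_sum (le_trans _ (CF _))// ler_nat.
    rewrite -(card_rtranslate _ h) -/(D h).
    rewrite (eq_bigr (fun x => if x \in D h then 1%N else 0%N)); last first.
      by move=> x _; case: (x \in D h).
    by rewrite -big_mkcond sum1_count count_le_card.
  rewrite -big_mkcond/= -mulr_sumr ler_pM2l ?invr_gt0//.
  rewrite -mulr_suml ler_pdivrMr// -natr_sum -natrM ler_nat.
  (* Double counting: for fixed [k] the points [k * g] are distinct, so at most as many of them fall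
     in the tile of [h] as [F (idx h)] has elements. *)
  rewrite (eq_bigr (fun g => \sum_(k <- F (idx h))
    ((k * g)%g \in tile h)))%N; last first.
    move=> g /eqP gh; rewrite card_fsetI_sum /tile gh.
    rewrite /rtranslate big_imfset//=.
    by move=> ? ? _ _; exact: mulIg.
  rewrite exchange_big/= -sum1_size big_distrl/=.
  apply: leq_sum => k _; rewrite mul1n.
  rewrite (leq_trans (n := \sum_(g <- l) ((k * g)%g \in tile h))%N)//.
    by rewrite [leqRHS](bigID (fun g => idx g == idx h))/= leq_addr.
  rewrite -card_fset_sum1 -(card_rtranslate _ h) -(card_ltranslate _ k^-1%g).
  rewrite (eq_bigr (fun g => if g \in ltranslate k^-1%g (tile h) then 1%N
    else 0%N)); last first.
    by move=> g _; rewrite mem_ltranslate invgK; case: (_ \in _).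
  by rewrite -big_mkcond sum1_count count_le_card.
rewrite -sum1_size natr_sum mulr_sumr.
apply: (@le_trans _ _ (\sum_(g <- l) \sum_(h <- S) (w1 g h + w2 g h))).
  by rewrite !big_seq; apply: ler_sum => g; exact: w_ge1.
by rewrite exchange_big/=; apply: ler_sum => h _; exact: sumw.
Qed.

End Greedy.

(** Together the two bounds give the union of the tiles at least [(1 - eta) / (C + eta^-1)] times as
    many points as the set [T] of candidate centres. *)
Lemma exists_tiling {R : realType} (F : nat -> {fset G}) (C eta : R)
    (idx : G -> nat) T :
  0 < eta -> eta <= 1 -> (forall n, F n != fset0) ->
  (forall n, #|` \big[@fsetU G/fset0]_(k < n) invmul (F k) (F n)|%:R
     <= C * #|` F n|%:R) ->
  exists S, [/\ {subset S <= T},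
    (1 - eta) * \sum_(g <- S) #|` F (idx g)|%:R <= #|` tiles F idx S|%:R
  & #|` T|%:R <= (C + eta^-1) * \sum_(g <- S) #|` F (idx g)|%:R].
Proof.
move=> eta0 eta1 F0 FC.
pose l := sort (relpre idx leq) T.
have sl : sorted (relpre idx leq) l.
  by apply: sort_sorted => x y /=; exact: leq_total.
have ul : uniq l by rewrite sort_uniq fset_uniq.
have [S [Sl S1 S2]] := greedy_tiles F eta1 sl.
exists S; split => //; first by move=> x /Sl; rewrite mem_sort.
have -> : #|` T| = size l by rewrite size_sort.
exact: (greedy_tiles_card eta0 ul F0 FC S2).
Qed.

Lemma folner_boundary {R : realType} (F : nat -> {fset G}) K (r : R) :
  folner R F -> 0 < r ->
  \forall n \near \oo, (boundary K (F n))%:R <= r * #|` F n|%:R.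
Proof.
move=> [F0 Fcvg] r0.
have : (\sum_(k <- K) (#|` symdiff (F n) (ltranslate k (F n))|%:R /
    #|` F n|%:R : R)) @[n --> \oo] --> (0 : R).
  elim: (K : seq G) => [|k s IH].
    by under eq_cvg do rewrite big_nil; exact: cvg_cst.
  have := cvgD (Fcvg k) IH; rewrite addr0 => H.
  by under eq_cvg do rewrite big_cons; exact: H.
move/cvgr0Pnorm_le => /(_ _ r0); apply: filterS => n.
rewrite -mulr_suml -natr_sum -/(boundary K (F n)) ger0_norm ?divr_ge0//.
by rewrite ler_pdivrMr// ltr0n cardfs_gt0.
Qed.

End Tiles.

(** * Covers by sets of small Bowen diameter *)

Lemma compact_finite_net {R : realType} {X : metricType R} (r : R) :
  compact [set: X] -> 0 < r ->
  exists D : {fset X}, forall x, exists2 y, y \in D & mdist y x < r.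
Proof.
move=> cX r0.
(* [up] consists of the properties shared by all large enough finite sets; any [D] containing [x]
   serves all points of [ball x r]. *)
pose up : set_system {fset X} :=
  fun P => exists A, forall B, (A `<=` B)%fset -> P B.
have up_filter : Filter up.
  split; first by exists fset0.
  - move=> P Q [A AP] [B BQ]; exists (A `|` B)%fset => C.
    by rewrite fsubUset => /andP[/AP ? /BQ].
  - by move=> P Q PQ [A AP]; exists A => B /AP /PQ.
have /compact_near_coveringP/(_ _ up
    (fun D x => exists2 y, y \in D & mdist y x < r) up_filter) := cX.
case=> [x _|D /(_ D (fsubset_refl D)) DX]; last first.
  by exists D => x; exact: DX.
exists (ball x r, [set D | x \in D]); first split => /=.
- exact: nbhsx_ballx.
- by exists [fset x]%fset => B; rewrite fsub1set.
- by move=> [x' D]/= [xx' xD]; exists x => //; move: xx'; rewrite ballEmdist.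
Qed.

Section Colorings.
Context {R : realType} {G : groupType} {X : metricType R}.
Variable a : G -> X -> X.
Implicit Types (T A B : {fset G}) (Z : set X) (e c : R) (x y z : X).
Implicit Types (E : {fset X}).

Local Notation dist := (bowen_dist a).

Lemma bowen_dist_ge0 T x y : 0 <= dist T x y.
Proof. exact: bigmax_ge_id. Qed.

Lemma bowen_dist_leP T x y e : 0 <= e ->
  dist T x y <= e <-> (forall g, g \in T -> mdist (a g x) (a g y) <= e).
Proof.
move=> e0; split=> [+ g gT|H].
  by apply: le_trans; rewrite /bowen_dist; apply: le_bigmax_seq gT _.
by rewrite /bowen_dist big_seq; apply: bigmax_le.
Qed.

Lemma bowen_dist_ltP T x y e : 0 < e ->
  dist T x y < e <-> (forall g, g \in T -> mdist (a g x) (a g y) < e).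
Proof.
move=> e0; split=> [+ g gT|H].
  by apply: le_lt_trans; rewrite /bowen_dist; apply: le_bigmax_seq gT _.
by rewrite /bowen_dist big_seq; apply: bigmax_lt.
Qed.

Lemma bowen_distxx T x : dist T x x = 0.
Proof.
apply/eqP; rewrite eq_le bowen_dist_ge0 andbT; apply/bowen_dist_leP => // g _.
by rewrite mdistxx.
Qed.

Lemma bowen_dist_sym T x y : dist T x y = dist T y x.
Proof. by apply: eq_bigr => g _; rewrite metric_sym. Qed.

Lemma bowen_dist_triangle T x y z : dist T x z <= dist T x y + dist T y z.
Proof.
apply/bowen_dist_leP => [|g gT]; first by rewrite addr_ge0 ?bowen_dist_ge0.
rewrite (le_trans (metric_triangle _ (a g y) _))// lerD//.
  by have /bowen_dist_leP := lexx (dist T x y); apply; rewrite ?bowen_dist_ge0.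
by have /bowen_dist_leP := lexx (dist T y z); apply; rewrite ?bowen_dist_ge0.
Qed.

Lemma bowen_ballS A B x e : 0 <= e -> {subset A <= B} ->
  bowen_ball a B x e `<=` bowen_ball a A x e.
Proof.
move=> e0 AB y /= /bowen_dist_leP => /(_ e0) xy.
apply/bowen_dist_leP => // g gA.
exact/xy/AB.
Qed.

Lemma bowen_ball_le A x (e e' : R) : e <= e' ->
  bowen_ball a A x e `<=` bowen_ball a A x e'.
Proof. by move=> ee' y /= /le_trans; apply. Qed.

(* [Z] is covered by at most [exp c] sets of [dist T]-diameter at most [e],
   presented as the fibres of [f]: covers of two sets then multiply by pairing
   colours, which makes [c] additive. *)
Definition coloring T Z e c :=
  exists (I : finType) (f : X -> I), #|I|%:R <= expR c /\
    forall x y, Z x -> Z y -> f x = f y -> dist T x y <= e.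

Lemma coloringS T A Z Z' e c c' : 0 <= e ->
  {subset A <= T} -> Z' `<=` Z -> c <= c' ->
  coloring T Z e c -> coloring A Z' e c'.
Proof.
move=> e0 AT ZZ cc [I [f [Ic fd]]]; exists I, f; split.
  by rewrite (le_trans Ic)// ler_expR.
move=> x y /ZZ Zx /ZZ Zy fxy; exact: (bowen_ballS e0 AT (fd x y Zx Zy fxy)).
Qed.

Lemma coloringU A B Z Z' e c c' : 0 <= e ->
  coloring A Z e c -> coloring B Z' e c' ->
  coloring (A `|` B)%fset (Z `&` Z') e (c + c').
Proof.
move=> e0 [I [f [Ic fd]]] [J [f' [Jc fd']]].
exists (I * J)%type, (fun x => (f x, f' x)); split.
  by rewrite card_prod natrM expRD ler_pM.
move=> x y [Zx Zx'] [Zy Zy'] [fxy fxy']; apply/bowen_dist_leP => // g.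
rewrite in_fsetU => /orP[] gT.
  by have /bowen_dist_leP := fd _ _ Zx Zy fxy; apply.
by have /bowen_dist_leP := fd' _ _ Zx' Zy' fxy'; apply.
Qed.

Lemma coloring0 Z e : 0 <= e -> coloring fset0 Z e 0.
Proof.
move=> e0; exists unit, (fun=> tt); rewrite card_unit expR0; split => //.
by move=> x y _ _ _; apply/bowen_dist_leP.
Qed.

Lemma coloring_card T Z e c E :
  coloring T Z e c -> separated_set a T Z e E -> #|` E|%:R <= expR c.
Proof.
move=> [I [f [Ic fd]]] [EZ sE]; apply: le_trans Ic; rewrite ler_nat.
have ufE : uniq [seq f x | x <- E].
  rewrite map_inj_in_uniq ?fset_uniq// => x y xE yE fxy.
  apply/eqP; apply: contraT => xy; have := sE _ _ xE yE xy.
  by rewrite ltNge fd//; exact: EZ.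
by rewrite -(size_map f) -(card_uniqP ufE) max_card.
Qed.

Section Action.
Hypothesis aM : forall g h x, a (g * h)%g x = a g (a h x).

(** For a left action, right translation of [T] only moves the base points; this is why tiles are
    right translates. *)
Lemma bowen_dist_rtranslate T g x y :
  dist (rtranslate T g) x y = dist T (a g x) (a g y).
Proof.
apply/eqP; rewrite eq_le; apply/andP; split; apply/bowen_dist_leP;
  rewrite ?bowen_dist_ge0// => h hT.
  have /bowen_dist_leP := lexx (dist T (a g x) (a g y)).
  rewrite bowen_dist_ge0 => /(_ isT (h * g^-1)%g).
  by rewrite -mem_rtranslate -!aM mulgVK; apply.
have /bowen_dist_leP := lexx (dist (rtranslate T g) x y).
rewrite bowen_dist_ge0 => /(_ isT (h * g)%g).
by rewrite mem_rtranslate mulgK !aM; apply.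
Qed.

Lemma coloring_rtranslate T Z e c g :
  coloring T Z e c -> coloring (rtranslate T g) (a g @^-1` Z) e c.
Proof.
move=> [I [f [Ic fd]]]; exists I, (f \o a g); split => // x y Zx Zy fxy.
by rewrite bowen_dist_rtranslate; exact: fd.
Qed.

Lemma coloring_tiles F idx (Z : G -> set X) e (c : G -> R) (S : seq G) :
  0 <= e ->
  (forall g, g \in S -> coloring (F (idx g)) (Z g) e (c g)) ->
  coloring (tiles F idx S) [set x | forall g, g \in S -> Z g (a g x)] e
    (\sum_(g <- S) c g).
Proof.
move=> e0; elim: S => [|g S IH] H.
  by rewrite /tiles !big_nil; exact: coloring0.
rewrite /tiles !big_cons -/(tiles F idx S).
have H1 := coloring_rtranslate g (H g (mem_head _ _)).
have SgS h : h \in S -> h \in g :: S by rewrite inE orbC => ->.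
have H2 := IH (fun h hS => H h (SgS h hS)).
apply: coloringS (coloringU e0 H1 H2) => //.
move=> x Zx; split; first exact/Zx/mem_head.
by move=> h hS; exact/Zx/SgS.
Qed.

(** A crude rate valid for every [T], obtained by recording one colour for each element of [T]. It
    starts the iteration and pays for negligible remainders. *)
Lemma compact_coloring e : compact [set: X] -> 0 < e ->
  exists2 L : R, 0 <= L & forall T, coloring T setT e (L * #|` T|%:R).
Proof.
move=> cX e0.
have : exists (I : finType) (f : X -> I),
    forall x y, f x = f y -> mdist x y <= e.
  have [D Dcov] := compact_finite_net cX (divr_gt0 e0 (ltr0Sn R 1)).
  pose P x (i : D) := ball (val i) (e / 2) x.
  have Pex x : exists i, P x i.
    have [i iD ix] := Dcov x; exists [` iD]%fset.
    by rewrite /P ballEmdist.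
  pose f x := sval (cid (Pex x)); exists D, f => x y fxy.
  have := svalP (cid (Pex x)); have := svalP (cid (Pex y)).
  rewrite -/(f y) -/(f x) -fxy /P => fy fx.
  have := ball_triangle (ball_sym fx) fy.
  by rewrite -splitr ballEmdist => /ltW.
move=> [I [f fd]]; pose L : R := #|I|%:R; exists L; first by rewrite ler0n.
move=> T.
have idxE : T = tiles (fun=> [fset 1%g]%fset) (fun=> 0%N) T.
  apply/fsetP => g; apply/idP/bigfcupP => [gT|[h]].
    by exists g; rewrite ?gT// mem_rtranslate inE mulgV.
  rewrite andbT mem_rtranslate inE => hT /eqP gh.
  by rewrite -(mulgVK h g) gh mul1g.
rewrite {1}idxE.
have L1 : coloring [fset 1%g]%fset setT e L.
  exists I, (f \o a 1%g); split.
    by rewrite (le_trans _ (expR_ge1Dx L))// lerDr.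
  move=> x y _ _ /fd xy; apply/bowen_dist_leP; rewrite ?(ltW e0)// => g.
  by rewrite inE => /eqP->.
have := @coloring_tiles (fun=> [fset 1%g]%fset) (fun=> 0%N) (fun=> setT) e
  (fun=> L) T (ltW e0) (fun _ _ => L1).
apply: coloringS => //; first exact: ltW.
by rewrite big_const_seq count_predT iter_addr addr0 mulr_natr.
Qed.

End Action.

(** A separated subset of maximal cardinality is spanning; the assumed bound makes the maximum
    exist. *)
Lemma exists_spanning T Z e c : 0 < e -> Z !=set0 ->
  (forall E, separated_set a T Z e E -> #|` E|%:R <= expR c) ->
  exists (E : {fset X}) , [/\ [set` E] `<=` Z, #|` E|%:R <= expR c,
    E != fset0 & forall x, Z x -> exists2 y, y \in E & dist T y x <= e].
Proof.
move=> e0 [z Zz] H.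
pose P n := `[< exists2 E, separated_set a T Z e E & #|` E| = n >].
have P1 : exists n, P n.
  exists 0%N; apply/asboolP; exists fset0; rewrite ?cardfs0//; split => //.
have [b bc] : exists b : nat, expR c <= b%:R.
  by exists (Num.bound (expR c)); apply/ltW/archi_boundP/expR_ge0.
have Pb n : P n -> (n <= b)%N.
  move=> /asboolP[E /H Ec <-]; by rewrite -(ler_nat R) (le_trans Ec).
have [n /asboolP[E sE En] nmax] := ex_maxnP P1 Pb.
have span x : Z x -> exists2 y, y \in E & dist T y x <= e.
  move=> Zx; apply: contrapT => nex.
  have far y : y \in E -> e < dist T y x.
    by move=> yE; rewrite ltNge; apply/negP => yx; apply: nex; exists y.
  have xE : x \notin E.
    by apply/negP => /far; rewrite bowen_distxx ltNge (ltW e0).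
  have : P n.+1.
    apply/asboolP; exists (x |` E)%fset; last by rewrite cardfsU1 xE En.
    split.
      by move=> y /=; rewrite !inE => /orP[/eqP->//|]; exact: sE.1.
    move=> u v; rewrite !inE => /orP[/eqP->|uE] /orP[/eqP->|vE] uv.
    - by rewrite eqxx in uv.
    - by rewrite bowen_dist_sym far.
    - exact: far.
    - exact: sE.2.
  by move=> /nmax; rewrite ltnn.
exists E; split => //; first exact: sE.1.
  exact: H.
by apply/fset0Pn; have [y yE _] := span z Zz; exists y.
Qed.

Lemma spanning_coloring T Z (e c : R) E : 0 <= e ->
  E != fset0 -> #|` E|%:R <= expR c ->
  (forall x, Z x -> exists2 y, y \in E & dist T y x <= e / 2) ->
  coloring T Z e c.
Proof.
move=> e0 /fset0Pn[y0 y0E] Ec span.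
pose P x (i : E) := Z x -> dist T (val i) x <= e / 2.
have Pex x : exists i, P x i.
  have [/span[y yE yx]|nZx] := pselect (Z x); first by exists [` yE]%fset.
  by exists [` y0E]%fset.
pose f x := sval (cid (Pex x)); exists E, f; split.
  by rewrite -cardfE.
move=> x y Zx Zy fxy.
have /(_ Zx) fx := svalP (cid (Pex x)); have /(_ Zy) := svalP (cid (Pex y)).
rewrite -/(f y) -fxy => fy; rewrite -/(f x) in fx.
rewrite (le_trans (bowen_dist_triangle T _ (val (f x)) _))//.
by rewrite [leRHS]splitr lerD// bowen_dist_sym.
Qed.

End Colorings.

(** * Covering rate over Bowen balls of the factor *)

Section FiberEntropy.
Context {R : realType} {G : groupType} {X Y : metricType R}.
Variables (a : G -> X -> X) (b : G -> Y -> Y) (p : X -> Y).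
Hypotheses (X_system : topological_system a) (p_factor : factor_map a b p).
Variable F : nat -> {fset G}.
Hypotheses (F_folner : folner R F) (F_tempered : tempered R F).

(** A tube argument: a point off the fibre has a neighbourhood whose image misses a small ball
    around [y], and compactness of [X] makes one radius work. *)
Lemma fiber_nbhs (O : set X) y : (forall x, p x = y -> nbhs x O) ->
  exists2 r : R, 0 < r & p @^-1` ball y r `<=` O.
Proof.
move=> fibO; have [/compact_near_coveringP cX _ _ _] := X_system.
have [p_cont _ _] := p_factor.
have : \forall r \near (0 : R)^'+, [set: X] `<=`
    (fun x => ball y r (p x) -> O x).
  apply: (cX R (0 : R)^'+ (fun r x => ball y r (p x) -> O x)) => x _.
  have [/fibO Ox|/eqP pxy] := eqVneq (p x) y.
    by exists (O, setT); [split => //; exact: filterT|move=> [x' r] [/=]].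
  pose d := mdist y (p x) / 2.
  have d0 : 0 < d by rewrite divr_gt0// mdist_gt0 eq_sym; exact/eqP.
  exists (p @^-1` ball (p x) d, [set r | r < d]); first split => /=.
  - by apply: p_cont; exact: nbhsx_ballx.
  - exact: nbhs_right_lt.
  - move=> [x' r]/= [] /ball_sym xx' rd /(le_ball (ltW rd)) yx'.
    by have := ball_triangle yx' xx'; rewrite -splitr ballEmdist/= ltxx.
move=> H; have [r [rO r0]] := filter_ex (filterI H (nbhs_right_gt (0 : R))).
by exists r => // x; exact: rO.
Qed.

Lemma bowen_dist_nbhs (T : {fset G}) x (r : R) : 0 < r ->
  nbhs x [set x' | bowen_dist a T x x' < r].
Proof.
move=> r0; have [_ _ _ a_cont] := X_system.
have : nbhs x [set x' | forall g, g \in (T : seq G) ->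
    mdist (a g x) (a g x') < r].
  elim: (T : seq G) => [|g s IH]; first exact: nearW.
  have : nbhs x (a g @^-1` ball (a g x) r).
    by apply: a_cont; exact: nbhsx_ballx.
  apply: filterS2 IH => x' IH; rewrite /= ballEmdist => gx h.
  by rewrite inE => /orP[/eqP->//|/IH].
by apply: filterS => x' xx'; apply/bowen_dist_ltP.
Qed.

(** A spanning set of the fibre over [y], for one good [n], still serves the preimage of a ball
    around [y]; compactness of [Y] then gives a common [M] and [r]. The scale is [e / 4] for the
    spanning set, [e / 2] after thickening, and [e] for diameters. *)
Lemma uniform_fiber_coloring (e B : R) : 0 < e ->
  (forall y, \forall n \near \oo, forall E,
    separated_set a (F n) (p @^-1` [set y]) (e / 4) E ->
    #|` E|%:R <= expR (B * #|` F n|%:R)) ->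
  compact [set: Y] ->
  forall N, exists M, exists2 r : R, 0 < r & forall z, exists n,
    [/\ (N <= n)%N, (n <= M)%N
      & coloring a (F n) (p @^-1` ball z r) e (B * #|` F n|%:R)].
Proof.
move=> e0 fibE /compact_near_coveringP cY N; have [_ p_surj _] := p_factor.
pose P (i : nat * R) z := exists n, [/\ (N <= n)%N, (n <= i.1)%N
  & coloring a (F n) (p @^-1` ball z i.2) e (B * #|` F n|%:R)].
have : filter_prod \oo (0 : R)^'+ (fun i => [set: Y] `<=` P i).
  refine (cY _ (filter_prod \oo (0 : R)^'+) P _ _) => y _.
  have [n [Nn nE]] := filter_ex (filterI (nbhs_infty_ge N) (fibE y)).
  have [||D [Dy Dc D0 Dspan]] := exists_spanning _ _ nE.
  - by rewrite divr_gt0.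
  - by have [x _ xy] := p_surj y I; exists x.
  pose O := [set x | exists2 x0, x0 \in D & bowen_dist a (F n) x0 x < e / 2].
  have [x pxy|r r0 rO] := @fiber_nbhs O y.
    have [x0 x0D x0x] := Dspan x pxy.
    have := bowen_dist_nbhs (F n) x (divr_gt0 e0 (ltr0Sn R 3)).
    apply: filterS => x' /= xx'; exists x0 => //.
    apply: le_lt_trans (bowen_dist_triangle a (F n) _ x _) _.
    by rewrite (_ : e / 2 = e / 4 + e / 4) ?ler_ltD//; lra.
  have cO : coloring a (F n) O e (B * #|` F n|%:R).
    apply: (spanning_coloring (ltW e0) D0 Dc) => x [x0 x0D /ltW x0x].
    by exists x0.
  exists (ball y (r / 2), [set i : nat * R | (n <= i.1)%N /\ i.2 < r / 2]).
    split => /=; first by apply: nbhsx_ballx; rewrite divr_gt0.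
    exists ([set M | (n <= M)%N], [set d : R | d < r / 2]); first split => /=.
    - exact: nbhs_infty_ge.
    - by apply: nbhs_right_lt; rewrite divr_gt0.
    - by case=> M d.
  case=> z [M d]/= [yz [nM dr]]; exists n; split => //=.
  apply: coloringS cO => //; first exact: ltW.
  apply: subset_trans rO => x /(le_ball (ltW dr)) zx.
  by have := ball_triangle yz zx; rewrite -splitr.
move=> H; have r_pos : filter_prod \oo (0 : R)^'+ (fun i : nat * R => 0 < i.2).
  exists (setT, [set d : R | 0 < d]); last by case=> M d [].
  split => /=; first exact: filterT.
  exact: nbhs_right_gt.
have [[M r] [MrP r0]] := filter_ex (filterI H r_pos).
by exists M; exists r => // z; exact: MrP.
Qed.

(** The bound concerns every sufficiently invariant [T], not only the sets [F n], because it has to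
    be applied again to the remainder of a tiling. *)
Definition fiber_rate (e r : R) := exists K (kap del : R),
  [/\ 0 < kap, 0 < del & forall T, (boundary K T)%:R <= kap * #|` T|%:R ->
    forall z, coloring a T (p @^-1` bowen_ball b T z del) e (r * #|` T|%:R)].

Lemma fiber_rateW (e r r' : R) : 0 <= e -> r <= r' ->
  fiber_rate e r -> fiber_rate e r'.
Proof.
move=> e0 rr [K [k [d [k0 d0 H]]]]; exists K, k, d; split => // T /H + z.
by move=> /(_ z); apply: coloringS => //; rewrite ler_wpM2r.
Qed.

(* One round of quasi-tiling: good tiles occupy a fixed proportion [c] of [T],
   and the rate hypothesis applies to the rest of [T] unless it is negligible. *)
Lemma fiber_rate_step (e B eta C A theta : R) :
  0 < e -> 0 < eta -> eta < 1 -> 0 < C -> 0 < theta -> 0 <= A ->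
  A * (1 - eta) = B ->
  (forall n, #|` \big[@fsetU G/fset0]_(k < n) invmul (F k) (F n)|%:R
     <= C * #|` F n|%:R) ->
  (forall N, exists M, exists2 r : R, 0 < r & forall z, exists n,
    [/\ (N <= n)%N, (n <= M)%N
      & coloring a (F n) (p @^-1` ball z r) e (B * #|` F n|%:R)]) ->
  fiber_rate e (A + theta) ->
  fiber_rate e (A + (1 - (1 - eta) / (C + eta^-1) / 2) * theta).
Proof.
move=> e0 eta0 eta1 C0 theta0 A0 AB FC lev [K [kap [del [kap0 del0 rate]]]].
have [cX _ aM _] := X_system; have [_ _ p_equi] := p_factor.
have [F0 _] := F_folner.
have [L L0 Lcol] := compact_coloring aM cX e0.
set D := C + eta^-1.
have D0 : 0 < D by rewrite addr_gt0 ?invr_gt0.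
set c := (1 - eta) / D.
have cD : c * D = 1 - eta by rewrite divfK// gt_eqF.
have c0 : 0 < c by rewrite divr_gt0// subr_gt0.
have c1 : c <= 1.
  rewrite ler_pdivrMr// mul1r; have : 1 <= eta^-1 by rewrite invf_ge1// ltW.
  by rewrite /D; lra.
(* The bound [2^-1] keeps at least half of [T] in the core; the other bound makes the crude cost of
   a negligible remainder at most [theta / 2] per point of [T]. *)
pose k2 : R := Num.min 2^-1 (theta * kap / (4 * (L + 1))).
have k2_half : k2 <= 2^-1 by rewrite ge_min lexx.
have k2_0 : 0 < k2.
  by rewrite lt_min invr_gt0 ltr0n/= divr_gt0 ?mulr_gt0//; lra.
have k2_L : 4 * (L * k2) <= theta * kap.
  have : k2 <= theta * kap / (4 * (L + 1)) by rewrite ge_min lexx orbT.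
  rewrite ler_pdivlMr; last by lra.
  by move: k2_0; nra.
have k1_0 : 0 < (1 - eta) * k2 by rewrite mulr_gt0// subr_gt0.
have [N _ NK] := folner_boundary K F_folner k1_0.
have [M [r r0 Mlev]] := lev N.
(* The sets [F n] with [n <= M] are included so that tiles centred in [core K' T] stay inside
   [T]. *)
pose K' := (K `|` \big[@fsetU G/fset0]_(n < M.+1) F n)%fset.
(* Halving [r] passes from closed Bowen balls to open balls of radius [r]. *)
exists K', k2, (Num.min del (r / 2)); split => //.
  by rewrite lt_min del0 divr_gt0.
move=> T TK' z; set del' := Num.min del (r / 2).
have [del'_del del'_r] : del' <= del /\ del' < r.
  rewrite /del' ge_min lexx; split => //.
  by rewrite gt_min; apply/orP; right; lra.
have del'_0 : 0 < del' by rewrite lt_min del0 divr_gt0.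
pose idx g := sval (cid (Mlev (b g z))).
have idxP g : [/\ (N <= idx g)%N, (idx g <= M)%N & coloring a (F (idx g))
    (p @^-1` ball (b g z) r) e (B * #|` F (idx g)|%:R)].
  exact: (svalP (cid (Mlev (b g z)))).
have [S [ST Scard Tcard]] :=
  @exists_tiling _ _ F C eta idx (core K' T) eta0 (ltW eta1) F0 FC.
set Sig := \sum_(g <- S) _ in Scard Tcard.
set U := tiles F idx S in Scard.
have UT : (U `<=` T)%fset.
  apply/fsubsetP => x /bigfcupP[g]; rewrite andbT mem_rtranslate => gS xg.
  have /coreP[_ /(_ (x * g^-1)%g)] := ST g gS; rewrite mulgVK; apply.
  rewrite in_fsetU; apply/orP; right; apply/bigfcupP.
  have [_ ltM _] := idxP g.
  by exists (Ordinal (ltM : (idx g < M.+1)%N)); rewrite ?mem_index_enum.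
pose V := (T `\` U)%fset.
have TUV : (U `|` V)%fset = T.
  apply/fsetP => x; rewrite !inE.
  by case: (boolP (x \in U)) => //= /(fsubsetP UT)->.
have cardT : #|` T|%:R = #|` U|%:R + #|` V|%:R :> R.
  by rewrite -natrD -(cardfsID U T) (fsetIidPr UT).
(* The sizes of the tiles add up to at most [1 / (1 - eta)] times the size of [U], which turns the
   rate [B] on tiles into [A] on [U]. *)
have colU : coloring a U (p @^-1` bowen_ball b T z del') e (A * #|` U|%:R).
  have := @coloring_tiles _ _ _ a aM F idx (fun g => p @^-1` ball (b g z) r) e
    (fun g => B * #|` F (idx g)|%:R) S (ltW e0)
    (fun g _ => let: And3 _ _ h := idxP g in h).
  apply: coloringS; rewrite ?(ltW e0)//.
    move=> x /= /bowen_dist_leP => /(_ (ltW del'_0)) xz g gS.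
    rewrite p_equi ballEmdist/=; apply: le_lt_trans del'_r; apply: xz.
    by have /coreP[] := ST g gS.
  by rewrite -mulr_sumr -AB -mulrA ler_wpM2l.
have Sig0 : 0 <= Sig by apply: sumr_ge0.
(* [T] and [U] each contribute at most [k2] per point of [T]: tile indices are at least [N], and
   [Sig] is at most the size of [T] divided by [1 - eta]. *)
have bdV : (boundary K V)%:R <= 2 * k2 * #|` T|%:R.
  have b1 : (boundary K T)%:R <= k2 * #|` T|%:R.
    apply: le_trans TK'; rewrite ler_nat boundaryS//; exact: fsubsetUl.
  have b2 : (boundary K U)%:R <= (1 - eta) * k2 * Sig.
    apply: le_trans (_ : (\sum_(g <- S) boundary K (F (idx g)))%:R <= _).
      by rewrite ler_nat boundary_tiles.
    rewrite natr_sum mulr_sumr; apply: ler_sum => g _.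
    by apply: NK => /=; have [] := idxP g.
  have b3 : (boundary K V)%:R <= (boundary K T)%:R + (boundary K U)%:R :> R.
    by rewrite -natrD ler_nat boundaryD.
  have UT' : #|` U|%:R <= #|` T|%:R :> R by rewrite ler_nat fsubset_leq_card.
  have := ler_wpM2l (ltW k2_0) (le_trans Scard UT').
  by move: b1 b2 b3; lra.
have half : c / 2 * #|` T|%:R <= #|` U|%:R.
  have t1 : #|` T|%:R <= #|` core K' T|%:R + (boundary K' T)%:R :> R.
    by rewrite -natrD ler_nat card_core.
  have t0 : 0 <= #|` T|%:R :> R by [].
  have t2 : 2^-1 * #|` T|%:R <= D * Sig.
    by have := ler_wpM2r t0 k2_half; move: t1 Tcard TK'; rewrite -/D; lra.
  have : c * (2^-1 * #|` T|%:R) <= c * (D * Sig) by rewrite ler_pM2l.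
  by rewrite (mulrA c D) cD mulrA => /le_trans; apply.
have V0 : 0 <= #|` V|%:R :> R by [].
suff [q colV qV] : exists2 q, coloring a V (p @^-1` bowen_ball b T z del') e q &
    A * #|` U|%:R + q <= (A + (1 - c / 2) * theta) * #|` T|%:R.
  have := coloringU (ltW e0) colU colV; rewrite TUV setIid.
  by apply: coloringS => //; exact: ltW.
(* Either [V] is invariant enough for the rate hypothesis, or its size is at most [2 * k2 / kap]
   times that of [T] and the crude rate [L] suffices, as [c <= 1]. *)
have [bdV'|bdV'] := leP (boundary K V)%:R (kap * #|` V|%:R).
  exists ((A + theta) * #|` V|%:R); last first.
    have := ler_wpM2l (ltW theta0) half; rewrite cardT; lra.
  apply: coloringS (rate V bdV' z) => //; first exact: ltW.
  move=> x xz; apply: (bowen_ball_le del'_del).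
  apply: bowen_ballS xz; first exact: ltW.
  by move=> g; rewrite in_fsetD => /andP[].
exists (L * #|` V|%:R).
  by apply: coloringS (Lcol V) => //; exact: ltW.
have v1 : kap * #|` V|%:R <= 2 * k2 * #|` T|%:R.
  exact: le_trans (ltW bdV') bdV.
have v2 : L * (kap * #|` V|%:R) <= L * (2 * k2 * #|` T|%:R).
  by rewrite ler_wpM2l.
have v3 : kap * (L * #|` V|%:R) <= kap * (theta / 2 * #|` T|%:R).
  have t0 : 0 <= #|` T|%:R :> R by [].
  by have := ler_wpM2r t0 k2_L; move: v2; lra.
rewrite ler_pM2l// in v3.
have v4 : 0 <= (1 - c) / 2 * theta * #|` T|%:R.
  by rewrite mulr_ge0 ?mulr_ge0 ?divr_ge0 ?subr_ge0// ltW.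
have v5 : 0 <= A * #|` V|%:R by rewrite mulr_ge0.
by move: v3 v4 v5; rewrite cardT; lra.
Qed.

End FiberEntropy.

(** * Iteration down to the rate of the fibres *)

Section UniformRate.
Context {R : realType} {G : groupType} {X Y : metricType R}.
Variables (a : G -> X -> X) (b : G -> Y -> Y) (p : X -> Y).
Hypotheses (X_system : topological_system a) (Y_system : topological_system b).
Hypothesis p_factor : factor_map a b p.
Variable F : nat -> {fset G}.
Hypotheses (F_folner : folner R F) (F_tempered : tempered R F).

Lemma limn_esup_lt (u : (\bar R)^nat) (l : \bar R) : (limn_esup u < l)%E ->
  \forall n \near \oo, (u n < l)%E.
Proof.
rewrite limn_esup_lim (_ : limn (esups u) = ereal_inf (range (esups u))).
  move=> /ereal_inf_lt[_ [N _ <-]] Nl; exists N => // n Nn.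
  apply: le_lt_trans Nl; apply: ereal_sup_ubound; exists n => //.
by apply/cvg_lim => //; exact: cvg_esups_inf.
Qed.

Lemma capacity_separated (Z : set X) (e s B : R) :
  (capacity_entropy_at a Z e F <= s%:E)%E -> s < B ->
  \forall n \near \oo, forall E, separated_set a (F n) Z e E ->
    #|` E|%:R <= expR (B * #|` F n|%:R).
Proof.
move=> Zs sB; have [F0 _] := F_folner.
have : (capacity_entropy_at a Z e F < B%:E)%E by exact: le_lt_trans Zs _.
move/limn_esup_lt; apply: filterS => n nB E sE.
have [->|E0] := eqVneq #|` E| 0%N; first exact: expR_ge0.
have E0' : 0 < #|` E|%:R :> R by rewrite ltr0n lt0n.
have Fgt0 : 0 < #|` F n|%:R :> R by rewrite ltr0n cardfs_gt0.
rewrite -[leLHS]lnK ?posrE// ler_expR.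
rewrite -ler_pdivrMr// mulrC -lee_fin EFinM -lne_EFin//.
apply: le_trans (ltW nB); apply: lee_wpmul2l; first by rewrite lee_fin invr_ge0.
have sN : (#|` E|%:R%:E <= separated_number a (F n) Z e)%E.
  by apply: ereal_sup_ubound; exists E.
rewrite lee_lne// in_itv/= leey andbT; first by rewrite lee_fin.
by rewrite (le_trans _ sN)// lee_fin.
Qed.

Lemma uniform_fiber_rate (e s r : R) : 0 < e -> 0 <= s -> s < r ->
  (forall y d, 0 < d ->
    (capacity_entropy_at a (p @^-1` [set y]) d F <= s%:E)%E) ->
  fiber_rate a b p e r.
Proof.
move=> e0 s0 sr fib.
(* [s < B < A < r]: separated sets in the fibres have rate [B], this [eta] makes tilings cost [A],
   and the gap up to [r] absorbs the excess left by the iteration. *)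
pose B := (s + r) / 2; pose A := (B + r) / 2; pose eta := 1 - B / A.
have sB : s < B by rewrite /B; lra.
have B0 : 0 < B by exact: le_lt_trans sB.
have BA : B < A by rewrite /A /B; lra.
have A0 : 0 < A by exact: lt_trans BA.
have Ar : A < r by rewrite /A /B; lra.
have eta0 : 0 < eta by rewrite subr_gt0 ltr_pdivrMr// mul1r.
have eta1 : eta < 1 by rewrite /eta ltrBlDr ltrDl divr_gt0.
have AB : A * (1 - eta) = B.
  by rewrite /eta opprB addrCA subrr addr0 mulrC divfK// gt_eqF.
have [C C0 FC] := F_tempered.
have [cX _ aM _] := X_system; have [cY _ _ _] := Y_system.
have e4 : 0 < e / 4 by rewrite divr_gt0.
have lev := uniform_fiber_coloring X_system p_factor e0
  (fun y => capacity_separated (fib y _ e4) sB) cY.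
set q := 1 - (1 - eta) / (C + eta^-1) / 2.
have step t : 0 < t -> fiber_rate a b p e (A + t) ->
    fiber_rate a b p e (A + q * t).
  move=> t0; exact: (fiber_rate_step X_system p_factor F_folner e0 eta0 eta1 C0
    t0 (ltW A0) AB FC lev).
have D0 : 0 < C + eta^-1 by rewrite addr_gt0 ?invr_gt0.
have q1 : q < 1 by rewrite /q ltrBlDr ltrDl !divr_gt0// subr_gt0.
have q0 : 0 < q.
  rewrite subr_gt0 ltr_pdivrMr// ltr_pdivrMr//.
  have : 1 <= eta^-1 by rewrite invf_ge1// ltW.
  lra.
have [L L0 Lcol] := compact_coloring aM cX e0.
(* Each round multiplies the excess over [A] by [q < 1]. Starting from [L + 1] instead of [L] keeps
   the excess positive even if [L] is 0. *)
have iter k : fiber_rate a b p e (A + q ^+ k * (L + 1)).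
  elim: k => [|k IH].
    exists fset0, 1, 1; split => // T _ z; apply: coloringS (Lcol T) => //.
      exact: ltW.
    by rewrite ler_wpM2r// expr0 mul1r; lra.
  rewrite exprS -mulrA; apply: step => //.
  by rewrite mulr_gt0 ?exprn_gt0//; lra.
have : q ^+ k * (L + 1) @[k --> \oo] --> 0 * (L + 1).
  by apply: cvgMr_tmp; apply: cvg_expr; rewrite ger0_norm// ltW.
rewrite mul0r => /cvgr_lt /(_ (r - A)).
rewrite subr_gt0 => /(_ Ar) /filter_ex[k kA].
by apply: fiber_rateW (iter k); [exact: ltW|move: kA; lra].
Qed.

Lemma uniform_fiber_rate_folner (e s r : R) : 0 < e -> 0 <= s -> s < r ->
  (forall y d, 0 < d ->
    (capacity_entropy_at a (p @^-1` [set y]) d F <= s%:E)%E) ->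
  exists2 d : R, 0 < d & \forall n \near \oo, forall z,
    coloring a (F n) (p @^-1` bowen_ball b (F n) z d) e (r * #|` F n|%:R).
Proof.
move=> e0 s0 sr fib.
have [K [k [d [k0 d0 rate]]]] := uniform_fiber_rate e0 s0 sr fib.
exists d => //; apply: filterS (folner_boundary K F_folner k0) => n.
exact: rate.
Qed.

(* Colour [x] by a point of a [d]-spanning subset of [W] near [p x], together
   with its colour over the Bowen ball of that point. *)
Lemma coloring_preimage (T : {fset G}) (W : set Y) (e d c c' : R) :
  0 < d -> 0 <= c -> 0 <= c' ->
  (forall E, separated_set b T W d E -> #|` E|%:R <= expR c) ->
  (forall z, coloring a T (p @^-1` bowen_ball b T z d) e c') ->
  coloring a T (p @^-1` W) e (c + c').
Proof.
move=> d0 c0 c'0 Wc col.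
have [->|/set0P W0] := eqVneq W set0.
  exists unit, (fun=> tt); split; last by [].
  by rewrite card_unit -expR0 ler_expR addr_ge0.
have [D [_ Dc /fset0Pn[y0 y0D] span]] := exists_spanning d0 W0 Wc.
have [J Jcol] := choice (fun y : D => col (val y)).
pose f y := sval (cid (Jcol y)); have fP y : _ := svalP (cid (Jcol y)).
pose P x (y : D) := W (p x) -> bowen_dist b T (val y) (p x) <= d.
have Pex x : exists y, P x y.
  have [/span[y yD yx]|nWx] := pselect (W (p x)); first by exists [` yD]%fset.
  by exists [` y0D]%fset.
have [near_pt near_ptP] := choice Pex.
exists {y : D & J y}, (fun x => Tagged J (f (near_pt x) x)); split.
  rewrite card_tagged sumnE big_map big_enum/= natr_sum expRD.
  apply: (@le_trans _ _ (\sum_(y : D) expR c')).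
    by apply: ler_sum => y _; have [] := fP y.
  rewrite sumr_const -cardfE -[leLHS]mulr_natl ler_wpM2r ?expR_ge0//.
move=> x x' Wx Wx' H.
have E : near_pt x = near_pt x' := congr1 tag H.
move: (near_ptP x') H; rewrite -E => x'P /eqP; rewrite eq_Tagged/= => /eqP ff.
have [_ fd] := fP (near_pt x); rewrite -/(f _) in fd.
apply: fd => //; last exact: x'P.
exact: near_ptP.
Qed.

End UniformRate.

(** * Packing entropy *)

Section LimitAtZero.
Context {R : realType}.
Variable f : R -> \bar R.
Hypothesis f_noninc : forall x y : R, 0 < x -> x <= y -> (f y <= f x)%E.

Let lim_sup : lim (f e @[e --> 0^'+]) =
  ereal_sup [set f e | e in `]0, +oo[%classic].
Proof.
apply/cvg_lim => //; apply: nonincreasing_at_right_cvge => // x y x0 _.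
by apply: f_noninc; move: x0; rewrite in_itv/= andbT.
Qed.

Lemma le_lim_at_right0 e : 0 < e -> (f e <= lim (f e @[e --> 0^'+]))%E.
Proof.
move=> e0; rewrite lim_sup; apply: ereal_sup_ubound.
by exists e; rewrite //= in_itv/= e0.
Qed.

Lemma lim_at_right0_le l : (forall e, 0 < e -> (f e <= l)%E) ->
  (lim (f e @[e --> 0^'+]) <= l)%E.
Proof.
move=> fl; rewrite lim_sup; apply: ge_ereal_sup => _ [e + <-].
by rewrite /= in_itv/= andbT; exact: fl.
Qed.

End LimitAtZero.

Section Packing.
Context {R : realType} {G : groupType} {X : metricType R}.
Variables (a : G -> X -> X) (F : nat -> {fset G}).
Implicit Types (Z : set X) (e s c t : R).
Local Open Scope ereal_scope.

Lemma packing_premeasure_at_ge0 Z N e s :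
  0 <= packing_premeasure_at a Z N e s F.
Proof.
apply: ereal_sup_ubound; exists set0; last by rewrite esum_set0.
by split => //; exact: countable0.
Qed.

Lemma packing_premeasure_at_nonincreasing Z e s :
  nonincreasing_seq (fun N => packing_premeasure_at a Z N e s F).
Proof.
move=> m n mn; apply: ge_ereal_sup => _ [I [cI IZ tI] <-].
apply: ereal_sup_ubound; exists I => //; split => // q /IZ[Zq nq]; split => //.
exact: leq_trans nq.
Qed.

Lemma packing_premeasureE Z e s : packing_premeasure a Z e s F =
  ereal_inf (range (fun N => packing_premeasure_at a Z N e s F)).
Proof.
apply/cvg_lim => //; apply: ereal_nonincreasing_cvgn.
exact: packing_premeasure_at_nonincreasing.
Qed.

Lemma packing_premeasure_ge0 Z e s : 0 <= packing_premeasure a Z e s F.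
Proof.
rewrite packing_premeasureE; apply/ereal_infP => _ [N _ <-].
exact: packing_premeasure_at_ge0.
Qed.

Lemma packing_measure_ge0 Z e s : 0 <= packing_measure a Z e s F.
Proof.
apply/ereal_infP => _ [Zs _ <-]; apply: nneseries_ge0 => i _ _.
exact: packing_premeasure_ge0.
Qed.

End Packing.

(** * Packing pre-measures against separated sets and covers *)

Section PackingTheory.
Context {R : realType} {G : groupType} {X : metricType R}.
Variables (a : G -> X -> X) (F : nat -> {fset G}).
Implicit Types (Z : set X) (e s c t : R).

(** [T] transports covers and pre-measures term by term: it is the identity when only the scale
    changes, and the image by [p] for the first inequality. *)
Lemma packing_measure_le {Y : metricType R} (b : G -> Y -> Y)
    (T : set X -> set Y) Z (W : set Y) e d s :
  (forall Zs : nat -> set X, Z `<=` \bigcup_i Zs i ->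
    W `<=` \bigcup_i T (Zs i)) ->
  (forall V N, (packing_premeasure_at b (T V) N d s F <=
    packing_premeasure_at a V N e s F)%E) ->
  (packing_measure b W d s F <= packing_measure a Z e s F)%E.
Proof.
move=> TW TP; apply/ereal_infP => _ [Zs ZZs <-].
apply: ge_ereal_inf; exists (\sum_(0 <= i <oo)
    packing_premeasure b (T (Zs i)) d s F)%E.
  by exists (T \o Zs) => //; exact: TW.
apply: lee_nneseries => [i _ _|i _]; first exact: packing_premeasure_ge0.
rewrite !packing_premeasureE; apply/ereal_infP => _ [N _ <-].
by apply: ge_ereal_inf; exists (packing_premeasure_at b (T (Zs i)) N d s F).
Qed.

Lemma packing_family_le Z N (e e' : R) I : e <= e' ->
  packing_family a Z N e' F I -> packing_family a Z N e F I.
Proof.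
move=> ee' [cI IZ tI]; split => // q q' Iq Iq' [x [qx q'x]].
by apply: tI => //; exists x; split; exact: bowen_ball_le ee' _ _.
Qed.

(** The size of [F n] is eventually at least [(2 / t) * ln n], whence the exponent 2. *)
Lemma growth_summable (t : R) : 0 < t ->
  (#|` F n|%:R / ln n%:R : R) @[n --> \oo] --> +oo ->
  \forall n \near \oo, expR (- t * #|` F n|%:R) <= n%:R ^- 2.
Proof.
move=> t0 /cvgryPge/(_ (2 / t)) => H; near=> n.
have n1 : 1 < n%:R :> R by rewrite ltr1n; near: n; exact: nbhs_infty_gt.
have ln0 : 0 < ln n%:R :> R by rewrite ln_gt0.
have : 2 / t <= #|` F n|%:R / ln n%:R by near: n.
rewrite ler_pdivlMr// mulrAC ler_pdivrMr// => nF.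
rewrite -[leRHS]lnK ?posrE ?invr_gt0 ?exprn_gt0 ?(lt_trans _ n1)// ler_expR.
rewrite lnV ?posrE ?exprn_gt0 ?(lt_trans _ n1)//.
rewrite lnXn ?(lt_trans _ n1)// mulNr lerN2.
by rewrite -[leLHS]mulr_natl [t * _]mulrC.
Unshelve. all: by end_near. Qed.

(** Telescoping, from [n ^- 2 <= (n - 1)^-1 - n^-1] for [n >= 2]. *)
Lemma sum_inv_square N M : (1 < N)%N ->
  \sum_(N <= n < M) (n%:R ^- 2 : R) <= (N.-1%:R)^-1.
Proof.
move=> N1; have [NM|MN] := leqP N M; last first.
  by rewrite big_geq ?invr_ge0// ltnW.
apply: (@le_trans _ _ (\sum_(N <= n < M) (- n.+1.-1%:R^-1 - - n.-1%:R^-1))).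
  apply: ler_sum_nat => n /andP[Nn _]; case: n Nn => [|[|n]].
  - by move=> /(leq_trans N1).
  - by move=> /(leq_trans N1).
  move=> _ /=; rewrite opprK addrC.
  have n1 : 0 < n.+1%:R :> R by rewrite ltr0n.
  have n2 : 0 < n.+2%:R :> R by rewrite ltr0n.
  rewrite -[X in X - _]mul1r -[X in _ - X]mul1r.
  rewrite -mulNr addf_div ?gt_eqF// mul1r mulN1r -natrB// subSnn.
  rewrite mul1r lef_pV2 ?posrE ?mulr_gt0 ?exprn_gt0// expr2 ler_pM2r//.
  by rewrite ler_nat.
rewrite (telescope_sumr (fun n => - n.-1%:R^-1))// opprK addrC.
by rewrite lerBlDr lerDl invr_ge0.
Qed.

(** In a packing the centres of index [n] are [(F n, e)]-separated, so at most [exp (c |F n|)] in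
    number. Grouping by index bounds the sum by a tail of [exp (- (t - c) |F n|)], hence of
    [n ^- 2]. *)
Lemma packing_premeasure_eq0 Z (e c t : R) : 0 < e -> c < t ->
  (#|` F n|%:R / ln n%:R : R) @[n --> \oo] --> +oo ->
  (\forall n \near \oo, coloring a (F n) Z e (c * #|` F n|%:R)) ->
  packing_premeasure a Z e t F = 0%E.
Proof.
move=> e0 ct F_growth Zcol; apply/eqP.
rewrite eq_le packing_premeasure_ge0 andbT packing_premeasureE.
have tc : 0 < t - c by rewrite subr_gt0.
have [N0 _ N0P] := filterI Zcol (growth_summable tc F_growth).
suff PN N : (1 < N)%N -> (N0 <= N)%N ->
    (packing_premeasure_at a Z N e t F <= (N.-1%:R^-1)%:E)%E.
  apply/lee_addgt0Pr => r r0; rewrite add0e.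
  have [m] : exists m : nat, r^-1 < m%:R.
    by exists (Num.bound r^-1); apply: archi_boundP; rewrite invr_ge0 ltW.
  move=> mr; pose N := (maxn m.+1 (maxn N0 2)).
  apply: ge_ereal_inf; exists (packing_premeasure_at a Z N e t F).
    by exists N.
  have N1 : (1 < N)%N by rewrite !leq_max leqnn !orbT.
  apply: le_trans (PN N N1 _) _; first by rewrite !leq_max leqnn orbT.
  rewrite lee_fin invf_ple ?posrE//; last by rewrite ltr0n -ltnS prednK// ltnW.
  rewrite (le_trans (ltW mr))// ler_nat -ltnS prednK; last exact: ltnW.
  by rewrite leq_max leqnn.
move=> N1 N0N; apply: ge_ereal_sup => _ [I [_ IZ tI] <-].
apply: ge_ereal_sup => _ [A [/finite_fsetP[J ->] JI] <-].
rewrite -fsbig_seq ?fset_uniq// sumEFin lee_fin.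
pose M := (\max_(q <- J) q.2).+1.
have JM q : q \in J -> (N <= q.2 < M)%N.
  move=> qJ; have [_ ->] := IZ _ (JI q qJ).
  by rewrite ltnS /= (@leq_bigmax_seq _ _ xpredT (fun q : X * nat => q.2)).
apply: le_trans (sum_inv_square M N1).
rewrite (_ : \sum_(q <- J) _ = \sum_(N <= n < M) \sum_(q <- J | n == q.2)
    expR (- t * #|` F n|%:R)); last first.
  rewrite (exchange_big_dep predT)//= big_seq [RHS]big_seq.
  apply: eq_bigr => q qJ; by rewrite big_nat1_eq JM.
apply: ler_sum_nat => n /andP[Nn _].
have [/coloring_card colE nsq] := N0P n (leq_trans N0N Nn).
apply: le_trans nsq; rewrite big_const_seq iter_addr addr0.
pose E := [fset q.1 | q in [fset q in J | n == q.2]]%fset.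
have EJ x : x \in E -> (x, n) \in J.
  by case/imfsetP => -[y m]; rewrite !inE/= => /andP[yJ /eqP ->] ->.
have sE : separated_set a (F n) Z e E.
  split=> [x /EJ/JI/IZ[]//|x y /EJ/JI Ix /EJ/JI Iy xy].
  rewrite ltNge; apply/negP => xye; move: xy.
  suff [->] : (x, n) = (y, n) by rewrite eqxx.
  apply: tI => //; exists y; split => //=.
  by rewrite /bowen_ball/= bowen_distxx; exact: ltW.
have -> : count (fun q : X * nat => n == q.2) J = #|` E|.
  rewrite -size_filter; symmetry; rewrite card_in_imfset/=; last first.
    by move=> [x k] [y l]; rewrite !inE/= => /andP[_ /eqP<-] /andP[_ /eqP<-] ->.
  apply/perm_size/uniq_perm; rewrite ?fset_uniq ?filter_uniq ?fset_uniq//.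
  by move=> q; rewrite mem_filter !inE andbC.
have cE := colE _ sE.
rewrite -[leLHS]mulr_natl; apply: le_trans (ler_wpM2r (expR_ge0 _) cE) _.
by rewrite -expRD ler_expR; lra.
Qed.

(** Closed balls of radius [d / 2] around [d]-separated points are disjoint, so the points of [E],
    all with index [n], form a packing family with sum [|E| exp (- s |F n|)]. *)
Lemma packing_separated Z N (d s : R) : 0 < d ->
  (packing_premeasure_at a Z N (d / 2) s F <= 1)%E ->
  forall n E, (N <= n)%N -> separated_set a (F n) Z d E ->
    #|` E|%:R <= expR (s * #|` F n|%:R).
Proof.
move=> d0 P1 n E Nn [EZ sE].
pose I := [set (x, n) | x in [set` E]].
have : (\esum_(q in I) (expR (- s * #|` F q.2|%:R))%:E <= 1)%E.
  apply: le_trans P1; apply: ereal_sup_ubound; exists I => //; split.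
  - apply: finite_set_countable; apply: finite_image; exact: finite_fset.
  - by move=> _ [x xE <-]; split => //; exact: EZ.
  - move=> _ _ [x xE <-] [y yE <-] [z [/= xz yz]].
    congr pair; apply/eqP; apply: contraT => xy.
    have := sE _ _ xE yE xy; rewrite ltNge => /negP[].
    apply: le_trans (bowen_dist_triangle a (F n) x z y) _.
    by rewrite [leRHS]splitr lerD// bowen_dist_sym.
rewrite esum_image => [|x y _ _ [->]//].
rewrite esum_fset; [|exact: finite_fset|by move=> *; rewrite lee_fin expR_ge0].
rewrite -fsbig_seq ?fset_uniq// sumEFin lee_fin/= big_const_seq iter_addr addr0.
rewrite count_predT mulNr expRN -[leLHS]mulr_natl.
by rewrite ler_pdivrMr ?expR_gt0// mul1r.
Qed.

End PackingTheory.

Section EntropyMonotone.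
Context {R : realType} {G : groupType} {X : metricType R}.
Variables (a : G -> X -> X) (F : nat -> {fset G}).
Implicit Types (Z : set X).

Lemma packing_entropy_at_ge0 Z (e : R) : (0 <= packing_entropy_at a Z e F)%E.
Proof. by apply/ereal_infP => _ [s [s0 _] <-]; rewrite lee_fin. Qed.

Lemma le_packing_entropy_at {Y : metricType R} (b : G -> Y -> Y) Z (W : set Y)
    (e d : R) :
  (forall s, packing_measure b W d s F <= packing_measure a Z e s F)%E ->
  (packing_entropy_at b W d F <= packing_entropy_at a Z e F)%E.
Proof.
move=> le; apply/ereal_infP => _ [s [s0 Zs] <-].
apply: ereal_inf_lbound; exists s => //; split => //; apply/eqP.
by rewrite eq_le packing_measure_ge0 andbT -Zs.
Qed.

Lemma packing_entropy_at_noninc Z (e e' : R) : 0 < e -> e <= e' ->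
  (packing_entropy_at a Z e' F <= packing_entropy_at a Z e F)%E.
Proof.
move=> _ ee'; apply: le_packing_entropy_at => s.
apply: (packing_measure_le (T := id)) => // V N.
apply: ge_ereal_sup => _ [I FI <-]; apply: ereal_sup_ubound.
by exists I => //; exact: packing_family_le FI.
Qed.

Lemma capacity_entropy_at_noninc Z (e e' : R) : 0 < e -> e <= e' ->
  (capacity_entropy_at a Z e' F <= capacity_entropy_at a Z e F)%E.
Proof.
move=> _ ee'.
have sN_ge0 n r : (0 <= separated_number a (F n) Z r)%E.
  by apply: ereal_sup_ubound; exists fset0; rewrite ?cardfs0//; split.
have sN_le n :
    (separated_number a (F n) Z e' <= separated_number a (F n) Z e)%E.
  apply: ge_ereal_sup => _ [E [EZ sE] <-]; apply: ereal_sup_ubound.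
  exists E => //; split => // x y xE yE xy.
  exact: le_lt_trans (sE _ _ xE yE xy).
rewrite /capacity_entropy_at !limn_esup_lim.
apply: lee_lim; [exact: is_cvg_esups|exact: is_cvg_esups|apply: nearW => n].
apply: ge_ereal_sup => _ [m /= nm <-].
apply: le_ereal_sup_tmp; eexists; first by exists m.
apply: lee_wpmul2l; first by rewrite lee_fin invr_ge0.
by rewrite lee_lne// in_itv/= leey andbT.
Qed.

End EntropyMonotone.

(** * The two inequalities for a factor map *)

Section Factor.
Context {R : realType} {G : groupType} {X Y : metricType R}.
Variables (a : G -> X -> X) (b : G -> Y -> Y) (p : X -> Y).
Hypotheses (X_system : topological_system a) (Y_system : topological_system b).
Hypothesis p_factor : factor_map a b p.
Variable F : nat -> {fset G}.

Lemma factor_uniformly_continuous (e : R) : 0 < e -> exists2 d : R, 0 < d &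
  forall x x', mdist x x' <= d -> mdist (p x) (p x') <= e.
Proof.
move=> e0; have [/compact_near_coveringP cX _ _ _] := X_system.
have [p_cont _ _] := p_factor.
have : \forall d \near (0 : R)^'+, [set: X] `<=`
    (fun x => forall x', mdist x x' <= d -> mdist (p x) (p x') <= e).
  apply: (cX R (0 : R)^'+
    (fun d x => forall x', mdist x x' <= d -> mdist (p x) (p x') <= e)) => x _.
  have /nbhs_ballP[r /= r0 rP] : nbhs x (p @^-1` ball (p x) (e / 2)).
    by apply: p_cont; apply: nbhsx_ballx; rewrite divr_gt0.
  exists (ball x (r / 2), [set d | d < r / 2]); first split => /=.
  - by apply: nbhsx_ballx; rewrite divr_gt0.
  - by apply: nbhs_right_lt; rewrite divr_gt0.
  move=> [x1 d]/= [xx1 dr] x2 x12.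
  have x1x2 : ball x1 (r / 2) x2 by rewrite ballEmdist/=; exact: le_lt_trans dr.
  have px1 : ball (p x) (e / 2) (p x1).
    by apply: rP; apply: le_ball xx1; rewrite ler_pdivrMr// ler_pMr// ler1n.
  have px2 : ball (p x) (e / 2) (p x2).
    by apply: rP; have := ball_triangle xx1 x1x2; rewrite -splitr.
  have := ball_triangle (ball_sym px1) px2.
  by rewrite -splitr ballEmdist => /ltW.
move=> H; have [d [dP d0]] := filter_ex (filterI H (nbhs_right_gt (0 : R))).
by exists d => // x; exact: dP.
Qed.

(** Centres are lifted by a section of [p] that sends the image of [Z] into [Z]. If two lifted balls
    of radius [d] meet, so do the original balls of radius [e]; hence the lifted family is a packing
    with the same sum. *)
Lemma packing_premeasure_at_factor (Z : set X) N (e d s : R) : 0 < e ->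
  (forall x x', mdist x x' <= d -> mdist (p x) (p x') <= e) -> 0 < d ->
  (packing_premeasure_at b (p @` Z) N e s F <=
   packing_premeasure_at a Z N d s F)%E.
Proof.
move=> e0 unif d0; have [_ p_surj p_equi] := p_factor.
have /choice[l lP] (y : Y) : exists x, p x = y /\ ((p @` Z) y -> Z x).
  have [[x Zx <-]|nZy] := pselect ((p @` Z) y).
    by exists x.
  by have [x _ xy] := p_surj y I; exists x; split.
have lb A x x' : bowen_dist a A x x' <= d -> bowen_dist b A (p x) (p x') <= e.
  move=> /bowen_dist_leP => /(_ (ltW d0)) xx'.
  apply/bowen_dist_leP => [|g gA]; first exact: ltW.
  by rewrite -!p_equi; exact/unif/xx'.
apply: ge_ereal_sup => _ [I [cI IZ tI] <-].
pose f (q : Y * nat) := (l q.1, q.2).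
have finj : injective f.
  by move=> [y m] [y' m'] [/(congr1 p)]; rewrite !(lP _).1 => -> ->.
apply: ereal_sup_ubound; exists (f @` I); last first.
  by rewrite esum_image// => ? ? _ _ /finj.
split.
- exact: sub_countable (card_image_le _ _) cI.
- by move=> _ [q Iq <-]; have [Zq nq] := IZ q Iq; split => //=; exact: (lP _).2.
- move=> _ _ [q Iq <-] [q' Iq' <-] [x [/= qx q'x]].
  congr f; apply: tI => //; exists (p x); rewrite /bowen_ball/=.
  by split; rewrite -[X in bowen_dist _ _ X](lP _).1; exact: lb.
Qed.

Lemma packing_entropy_factor (E : set X) :
  (packing_entropy b (p @` E) F <= packing_entropy a E F)%E.
Proof.
apply: lim_at_right0_le => [x y|e e0]; first exact: packing_entropy_at_noninc.
have [d d0 unif] := factor_uniformly_continuous e0.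
apply: le_trans (le_lim_at_right0 _ d0); last first.
  by move=> x y; exact: packing_entropy_at_noninc.
apply: le_packing_entropy_at => s.
apply: (packing_measure_le (T := fun V => p @` V)) => [Zs ZZs _ [x Ex <-]|V N].
  by have [i _ xi] := ZZs x Ex; exists i => //; exists x.
exact: packing_premeasure_at_factor.
Qed.

Hypotheses (F_folner : folner R F) (F_tempered : tempered R F).
Hypothesis F_growth : (#|` F n|%:R / ln n%:R : R) @[n --> \oo] --> +oo.

(** If the packing measure of the image of [E] vanishes at [u], that image has a countable cover by
    sets of small pre-measure at scale [d / 2]. Their preimages are eventually coloured at rate
    [u + q], so their pre-measures vanish at [u + r]. *)
Lemma packing_entropy_at_fiber (E : set X) (e s r : R) :
  0 < e -> 0 <= s -> s < r ->
  (forall y d, 0 < d ->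
    (capacity_entropy_at a (p @^-1` [set y]) d F <= s%:E)%E) ->
  exists2 d : R, 0 < d &
    (packing_entropy_at a E e F <= packing_entropy_at b (p @` E) d F + r%:E)%E.
Proof.
move=> e0 s0 sr fib; pose q := (s + r) / 2.
have sq : s < q by rewrite /q; lra.
have qr : q < r by rewrite /q; lra.
have q0 : 0 <= q by exact/ltW/(le_lt_trans s0).
have [d d0 col] := uniform_fiber_rate_folner X_system Y_system p_factor
  F_folner F_tempered e0 s0 sq fib.
exists (d / 2); first by rewrite divr_gt0.
rewrite -leeBlDr//; apply/ereal_infP => _ [u [u0 Wu] <-]; rewrite leeBlDr//.
apply: ereal_inf_lbound; exists (u + r) => //; split.
  by rewrite addr_ge0// ltW// (le_lt_trans q0).
have [_ [Ws WWs <-] Wlt1] : exists2 x, [set \sum_(0 <= i <oo)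
    packing_premeasure b (Zs i) (d / 2) u F
  | Zs in [set Zs : nat -> set Y | p @` E `<=` \bigcup_i Zs i]]%E x & (x < 1)%E.
  by apply: ereal_inf_lt; rewrite -/(packing_measure _ _ _ _ _) Wu lte01.
apply/eqP; rewrite eq_le packing_measure_ge0 andbT.
apply: ge_ereal_inf; exists (\sum_(0 <= i <oo)
    packing_premeasure a (p @^-1` Ws i) e (u + r) F)%E.
  exists (fun i => p @^-1` Ws i) => // x Ex.
  by have [i _ xi] := WWs (p x) (ex_intro2 _ _ x Ex erefl); exists i.
rewrite eseries0// => i _ _.
apply: (@packing_premeasure_eq0 _ _ _ _ _ _ _ (u + q)) => //.
  by rewrite ltrD2l.
(* One term of a nonnegative series is at most its sum; being below 1, this pre-measure is the limit
   of values that are at most 1 from some [N] on, as [packing_separated] requires. *)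
have : (packing_premeasure b (Ws i) (d / 2) u F < 1)%E.
  apply: le_lt_trans Wlt1.
  apply: le_trans (nneseries_lim_ge i.+1 _); last first.
    by move=> *; exact: packing_premeasure_ge0.
  rewrite big_nat_recr//= leeDr// sume_ge0// => *.
  exact: packing_premeasure_ge0.
rewrite packing_premeasureE => /ereal_inf_lt[_ [N _ <-]] /ltW N1.
have sep := packing_separated d0 N1.
near=> n.
rewrite mulrDl; apply: (@coloring_preimage _ _ _ _ _ _ _ _ _ _ d) => //.
- by rewrite mulr_ge0.
- by rewrite mulr_ge0.
- by move=> E'; apply: sep; near: n; exact: nbhs_infty_ge.
- by near: n.
Unshelve. all: by end_near. Qed.

Lemma fiber_capacity_le (s : R) y (d : R) : 0 < d ->
  fiber_capacity_entropy a p F = s%:E ->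
  (capacity_entropy_at a (p @^-1` [set y]) d F <= s%:E)%E.
Proof.
move=> d0 <-; rewrite /fiber_capacity_entropy le_max; apply/orP; right.
apply: (@le_trans _ _ (capacity_entropy a (p @^-1` [set y]) F)).
  apply: le_lim_at_right0 => // e e'; exact: capacity_entropy_at_noninc.
by apply: ereal_sup_ubound; exists y.
Qed.

Lemma packing_entropy_fiber (E : set X) :
  (packing_entropy a E F <=
     packing_entropy b (p @` E) F + fiber_capacity_entropy a p F)%E.
Proof.
have noninc (Z : set Y) (x y : R) : 0 < x -> x <= y ->
    (packing_entropy_at b Z y F <= packing_entropy_at b Z x F)%E.
  exact: packing_entropy_at_noninc.
have h0 : (0 <= packing_entropy b (p @` E) F)%E.
  apply: le_trans (packing_entropy_at_ge0 b F (p @` E) 1) _.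
  exact: (le_lim_at_right0 (noninc _) ltr01).
have : (0 <= fiber_capacity_entropy a p F)%E by rewrite le_max lexx.
(* When this is [+oo], so is the right-hand side, because the packing entropy is nonnegative and
   thus not [-oo]. *)
case fib : fiber_capacity_entropy => [s| |]//; last first.
  by move=> _; rewrite addey ?leey// gt_eqF// (lt_le_trans _ h0).
rewrite lee_fin => s0.
apply: lim_at_right0_le => [x y|e e0]; first exact: packing_entropy_at_noninc.
(* The covering rate must lie strictly above [s], hence the slack [t]. *)
apply/lee_addgt0Pr => t t0; rewrite -addeA -EFinD.
have [|d d0 le] := @packing_entropy_at_fiber E e s (s + t) e0 s0 _
  (fun y d d0 => fiber_capacity_le y d0 fib).
  by rewrite ltrDl.
apply: le_trans le _; rewrite leeD2r//.
exact: (le_lim_at_right0 (noninc _) d0).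
Qed.

End Factor.

Theorem theorem1p4 (R : realType) (G : groupType)
    (G_countable : countable [set: G])
    (G_infinite : infinite_set [set: G])
    (G_amenable : amenable R G)
    (X Y : metricType R) (a : G -> X -> X) (b : G -> Y -> Y)
    (X_system : topological_system a) (Y_system : topological_system b)
    (p : X -> Y) (p_factor : factor_map a b p)
    (F : nat -> {fset G})
    (F_folner : folner R F) (F_tempered : tempered R F)
    (F_growth : (#|` F n|%:R / ln n%:R : R) @[n --> \oo] --> +oo)
    (E : set X) (E_borel : borel E) :
  (packing_entropy b (p @` E) F <= packing_entropy a E F)%E /\
  (packing_entropy a E F <=
     packing_entropy b (p @` E) F + fiber_capacity_entropy a p F)%E.
Proof.
split; first exact: (packing_entropy_factor X_system p_factor).
exact: (packing_entropy_fiber X_system Y_system p_factor F_folner F_tempered).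
Qed.
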